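(* Let $K$ be a field with $|K|=\aleph_0$ and $\operatorname{char}K\neq 2$, let $F_2$ be the free group with $2$ generators, let $\{V_j\mid j\in J\}$ be the set of all finitely generated right ideals of $KF_2$, and let $V=\prod_{j\in J}\left(KF_2/V_j\right)$, regarded as a right $KF_2$-module. Then the representation $(V,F_2)$ is not action type logically Noetherian.
   Context: A representation $(V,G)$ over a commutative ring $K$ with unit is a group $G$ together with a right $KG$-module $V$ (action written $v\circ g$). A homomorphism of representations $(\alpha,\beta):(V,G)\to(W,H)$ is a $K$-module homomorphism $\alpha:V\to W$ together with a group homomorphism $\beta:G\to H$ such that $(v\circ g)^\alpha=v^\alpha\circ g^\beta$ for all $v\in V$, $g\in G$. For finite sets $X,Y$ let $F(Y)$ be the free group on $Y$, $XKF(Y)=\bigoplus_{x\in X}xKF(Y)$ the free right $KF(Y)$-module with basis $X$, and $W(X,Y)=(XKF(Y),F(Y))$ (the free representation on $X,Y$). For $T\subset XKF(Y)$ put $T^{\nabla}_{(V,G)}=\{(\alpha,\beta)\in\mathrm{Hom}(W(X,Y),(V,G))\mid \ker\alpha\supset T\}$ and $T^{\nabla\nabla}_{(V,G)}=\bigcap_{(\alpha,\beta)\in T^{\nabla}_{(V,G)}}\ker\alpha$. $(V,G)$ is called action type logically Noetherian if for all finite sets $X,Y$, every $T\subset XKF(Y)$ and every $w\in T^{\nabla\nabla}_{(V,G)}$ there is a finite subset $T_0\subset T$ such that $w\in (T_0)^{\nabla\nabla}_{(V,G)}$. *)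

(* Defs.v *)
From HB Require Import structures.
From mathcomp Require Import all_boot all_algebra finmap.
From mathcomp Require Import boolp classical_sets functions cardinality.
From mathcomp Require Import monalg.

Set Implicit Arguments.
Unset Strict Implicit.
Unset Printing Implicit Defensive.

Import GRing.Theory.

Local Open Scope classical_set_scope.
Local Open Scope ring_scope.

(* A letter [(y, b)] stands for [y] if [b = false] and for the
   inverse of [y] if [b = true]; the elements of [free_group Y] are the reduced
   words, i.e. those without two consecutive mutually inverse letters. *)

Section FreeGroup.
Context (Y : choiceType).
Implicit Types (a b : Y * bool) (w : seq (Y * bool)).

Definition letter_inv a : Y * bool := (a.1, ~~ a.2).

Definition reduced w : bool := sorted (fun a b => b != letter_inv a) w.

Definition push a w :=
  if w is b :: w' then if b == letter_inv a then w' else a :: w else [:: a].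

Definition word_mul w1 w2 := foldr push w2 w1.

Definition word_inv w := rev (map letter_inv w).

Record free_group := FreeGroup { fg_word : seq (Y * bool); _ : reduced fg_word }.

HB.instance Definition _ := [isSub for fg_word].
HB.instance Definition _ := [Choice of free_group by <:].

Lemma letter_invK : involutive letter_inv.
Proof. by case=> y b; rewrite /letter_inv /= negbK. Qed.

Lemma letter_inv_neq a : letter_inv a != a.
Proof. by case: a => y b; rewrite /letter_inv xpair_eqE eqxx; case: b. Qed.

Lemma reduced_cons a w :
  reduced (a :: w) = (if w is b :: _ then b != letter_inv a else true) && reduced w.
Proof. by case: w. Qed.

Lemma reduced_push a w : reduced w -> reduced (push a w).
Proof.
case: w => [//|b w] rw; rewrite /push; case: ifPn => [_|ba].
  by move: rw; rewrite reduced_cons => /andP[].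
by rewrite reduced_cons ba.
Qed.

Lemma reduced_mul w1 w2 : reduced w2 -> reduced (word_mul w1 w2).
Proof. by move=> r2; elim: w1 => //= a w1; apply: reduced_push. Qed.

Lemma reduced_inv w : reduced w -> reduced (word_inv w).
Proof.
rewrite /reduced /word_inv rev_sorted sorted_map.
by rewrite (eq_sorted (e' := fun a b => b != letter_inv a)) // => a b;
  rewrite /= letter_invK eq_sym.
Qed.

Lemma pushK a w : reduced w -> push (letter_inv a) (push a w) = w.
Proof.
case: w => [_|b w]; rewrite /push ?letter_invK ?eqxx //.
case: ifPn => [/eqP -> |_ _]; last by rewrite eqxx.
by rewrite reduced_cons; case: w => [//|c w]; rewrite letter_invK => /andP[/negPf ->].
Qed.

Lemma mul_push a w1 w2 : reduced w1 -> reduced w2 ->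
  word_mul (push a w1) w2 = push a (word_mul w1 w2).
Proof.
case: w1 => [//|b w1] r1 r2; rewrite {1}/push; case: ifPn => [/eqP -> /=|//].
have := pushK (letter_inv a) (reduced_mul w1 r2).
by rewrite letter_invK => ->.
Qed.

Lemma word_mulA w1 w2 w3 : reduced w2 -> reduced w3 ->
  word_mul w1 (word_mul w2 w3) = word_mul (word_mul w1 w2) w3.
Proof.
move=> r2 r3; elim: w1 => //= a w1 ->.
by rewrite mul_push // reduced_mul.
Qed.

Lemma word_mulw1 w : reduced w -> word_mul w [::] = w.
Proof.
elim: w => [//|a w IHw]; rewrite reduced_cons => /andP[aw rw].
by rewrite /= IHw //; case: w aw {IHw rw} => //= b w /negPf ->.
Qed.

Lemma word_mulVw w : reduced w -> word_mul (word_inv w) w = [::].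
Proof.
elim: w => [//|a w IHw] raw; have rw : reduced w.
  by move: raw; rewrite reduced_cons => /andP[].
by rewrite /word_inv /= rev_cons -cats1 /word_mul foldr_cat /= letter_invK eqxx;
   apply: IHw.
Qed.

Lemma word_invK : involutive word_inv.
Proof.
by move=> w; rewrite /word_inv map_rev revK mapK //; apply: letter_invK.
Qed.

Definition fg_one := FreeGroup (isT : reduced [::]).
Definition fg_inv (u : free_group) := FreeGroup (reduced_inv (valP u)).
Definition fg_mul (u v : free_group) :=
  FreeGroup (reduced_mul (fg_word u) (valP v)).

Lemma fg_mulA : associative fg_mul.
Proof.
by move=> u v w; apply: val_inj; rewrite /= word_mulA //; apply: valP.
Qed.

Lemma fg_mul1 : left_id fg_one fg_mul.
Proof. by move=> u; apply: val_inj. Qed.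

Lemma fg_mulr1 : right_id fg_one fg_mul.
Proof. by move=> u; apply: val_inj; rewrite /= word_mulw1 //; apply: (valP u). Qed.

Lemma fg_mulV : left_inverse fg_one fg_inv fg_mul.
Proof. by move=> u; apply: val_inj; rewrite /= word_mulVw //; apply: (valP u). Qed.

Lemma fg_mulrV : right_inverse fg_one fg_inv fg_mul.
Proof.
move=> u; apply: val_inj; rewrite /= -{1}[fg_word u]word_invK word_mulVw //.
by apply: reduced_inv; apply: (valP u).
Qed.

HB.instance Definition _ :=
  isGroup.Build free_group fg_mulA fg_mul1 fg_mulr1 fg_mulV fg_mulrV.

Definition free_gen (y : Y) : free_group :=
  FreeGroup (isT : reduced [:: (y, false)]).

End FreeGroup.

(* The library turns [{malg K[G]}] into a ring only for
   monoids without non-trivial units, hence the copy of the carrier and the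
   convolution product. *)

Definition group_algebra (K : comNzRingType) (G : groupType) := {malg K[G]}.

Section GroupAlgebra.
Context (K : comNzRingType) (G : groupType).
Local Notation KG := (group_algebra K G).
Implicit Types (x y z : {malg K[G]}) (g h : G) (c : K).

HB.instance Definition _ := GRing.Lmodule.on KG.

Definition ga_one : {malg K[G]} := << 1%g >>.

Definition ga_mul x y : {malg K[G]} :=
  \sum_(g <- msupp x) \sum_(h <- msupp y) << x@_g * y@_h *g (g * h)%g >>.

Lemma ga_mulw (d1 d2 : {fset G}) x y :
  (msupp x `<=` d1)%fset -> (msupp y `<=` d2)%fset ->
  ga_mul x y = \sum_(g <- d1) \sum_(h <- d2) << x@_g * y@_h *g (g * h)%g >>.
Proof.
move=> le_d1 le_d2; rewrite /ga_mul (big_fset_incl _ le_d1) /=.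
  apply/eq_bigr=> g _; apply/big_fset_incl => // h _ /mcoeff_outdom ->.
  by rewrite mulr0 monalgU0.
move=> g _ /mcoeff_outdom xg.
by rewrite big1 // => h _; rewrite xg mul0r monalgU0.
Qed.

Lemma ga_mulDl : left_distributive ga_mul +%R.
Proof.
move=> x y z.
rewrite [in RHS](ga_mulw (fsubsetUl _ (msupp y)) (fsubset_refl _)).
rewrite [in RHS](ga_mulw (fsubsetUr (msupp x) _) (fsubset_refl _)).
rewrite (ga_mulw (msuppD_le _ _) (fsubset_refl _)).
rewrite -big_split /=; apply/eq_bigr=> g _.
rewrite -big_split /=; apply/eq_bigr=> h _.
by rewrite mcoeffD mulrDl monalgUD.
Qed.

Lemma ga_mulDr : right_distributive ga_mul +%R.
Proof.
move=> z x y.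
rewrite [in RHS](ga_mulw (fsubset_refl _) (fsubsetUl _ (msupp y))).
rewrite [in RHS](ga_mulw (fsubset_refl _) (fsubsetUr (msupp x) _)).
rewrite (ga_mulw (fsubset_refl _) (msuppD_le _ _)).
rewrite -big_split /=; apply/eq_bigr=> g _.
rewrite -big_split /=; apply/eq_bigr=> h _.
by rewrite mcoeffD mulrDr monalgUD.
Qed.

Lemma ga_mul0l : left_zero 0 ga_mul.
Proof. by move=> x; rewrite /ga_mul msupp0 big_seq_fset0. Qed.

Lemma ga_mul0r : right_zero 0 ga_mul.
Proof. by move=> x; rewrite /ga_mul msupp0 big1 // => g _; rewrite big_seq_fset0. Qed.

Lemma ga_mulU c g x :
  ga_mul << c *g g >> x = \sum_(h <- msupp x) << c * x@_h *g (g * h)%g >>.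
Proof.
rewrite (ga_mulw msuppU_le (fsubset_refl _)) big_seq_fset1.
by apply/eq_bigr => h _; rewrite mcoeffUU.
Qed.

Lemma ga_mulrU c g x :
  ga_mul x << c *g g >> = \sum_(h <- msupp x) << x@_h * c *g (h * g)%g >>.
Proof.
rewrite (ga_mulw (fsubset_refl _) msuppU_le).
by apply/eq_bigr => h _; rewrite big_seq_fset1 mcoeffUU.
Qed.

Lemma ga_mulUU c1 c2 g1 g2 :
  ga_mul << c1 *g g1 >> << c2 *g g2 >> = << c1 * c2 *g (g1 * g2)%g >>.
Proof. by rewrite (ga_mulw msuppU_le msuppU_le) !big_seq_fset1 !mcoeffUU. Qed.

Lemma ga_mul_suml I (r : seq I) (F : I -> {malg K[G]}) y :
  ga_mul (\sum_(i <- r) F i) y = \sum_(i <- r) ga_mul (F i) y.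
Proof. exact: (big_morph (ga_mul^~ y) (fun _ _ => ga_mulDl _ _ _) (ga_mul0l _)). Qed.

Lemma ga_mul_sumr I (r : seq I) (F : I -> {malg K[G]}) x :
  ga_mul x (\sum_(i <- r) F i) = \sum_(i <- r) ga_mul x (F i).
Proof. exact: (big_morph (ga_mul x) (fun _ _ => ga_mulDr _ _ _) (ga_mul0r _)). Qed.

Lemma ga_mulA : associative ga_mul.
Proof.
move=> x y z; rewrite [x]monalgE !ga_mul_suml; apply/eq_bigr=> g _.
rewrite [y]monalgE !(ga_mul_suml, ga_mul_sumr); apply/eq_bigr=> h _.
rewrite [z]monalgE !(ga_mul_suml, ga_mul_sumr); apply/eq_bigr=> k _.
by rewrite !ga_mulUU mulrA mulgA.
Qed.

Lemma ga_mul1l : left_id ga_one ga_mul.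
Proof.
move=> x; rewrite ga_mulU [RHS]monalgE.
by apply/eq_bigr=> h _; rewrite mul1r mul1g.
Qed.

Lemma ga_mul1r : right_id ga_one ga_mul.
Proof.
move=> x; rewrite ga_mulrU [RHS]monalgE.
by apply/eq_bigr=> h _; rewrite mulr1 mulg1.
Qed.

Lemma ga_one_neq0 : ga_one != 0.
Proof. by apply/eqP/malgP=> /(_ 1%g) /eqP; rewrite !mcoeffsE oner_eq0. Qed.

HB.instance Definition _ := GRing.Zmodule_isNzRing.Build KG
  ga_mulA ga_mul1l ga_mul1r ga_mulDl ga_mulDr ga_one_neq0.

Lemma ga_scaleE c x : c *: x = \sum_(g <- msupp x) << c * x@_g *g g >>.
Proof. by []. Qed.

Lemma ga_scaleAl c (x y : KG) : c *: (x * y) = (c *: x) * y.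
Proof.
have cE (z : KG) : c *: z = ga_mul << c *g 1%g >> z.
  by rewrite ga_scaleE ga_mulU; apply/eq_bigr=> h _; rewrite mul1g.
by rewrite !cE; apply: ga_mulA.
Qed.

HB.instance Definition _ := GRing.Lmodule_isLalgebra.Build K KG ga_scaleAl.

Lemma ga_scaleAr c (x y : KG) : c *: (x * y) = x * (c *: y).
Proof.
have cE (z : KG) : c *: z = ga_mul << c *g 1%g >> z.
  by rewrite ga_scaleE ga_mulU; apply/eq_bigr=> h _; rewrite mul1g.
have cE' (z : KG) : c *: z = ga_mul z << c *g 1%g >>.
  by rewrite ga_scaleE ga_mulrU; apply/eq_bigr=> h _; rewrite mulg1 mulrC.
by rewrite [in RHS]cE cE' -[_ * _]/(ga_mul x y) -ga_mulA -cE' cE.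
Qed.

HB.instance Definition _ := GRing.Lalgebra_isAlgebra.Build K KG ga_scaleAr.

Definition ga_elt g : KG := << g >>.

Lemma ga_eltM g h : ga_elt (g * h)%g = ga_elt g * ga_elt h.
Proof. by rewrite -[RHS]/(ga_mul _ _) ga_mulUU mulr1. Qed.

End GroupAlgebra.

(* Right modules over a ring [A] are left modules over the converse ring [A^c]:
   for [a : A] and [v : V], the vector [v . a] is [(a : A^c) *: v]. *)
Notation right_module A := (GRing.Lmodule.type A^c).

Definition right_scale (A : nzRingType) (V : right_module A) (v : V) (a : A) : V :=
  (a : A^c) *: v.

Record representation (K : comNzRingType) := Representation {
  rep_group : groupType;
  rep_module : right_module (group_algebra K rep_group)
}.

Section Representations.
Context (K : comNzRingType).
Implicit Types A B : representation K.

Definition rep_act A (v : rep_module A) (g : rep_group A) : rep_module A :=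
  right_scale v (ga_elt K g).

Lemma rep_act_mul A (v : rep_module A) (g h : rep_group A) :
  rep_act v (g * h)%g = rep_act (rep_act v g) h.
Proof. by rewrite /rep_act /right_scale scalerA ga_eltM. Qed.

(* The [K]-module structure underlying a right [KG]-module. *)
Definition rep_scale A (c : K) (v : rep_module A) : rep_module A :=
  right_scale v c%:A.

Record rep_hom A B := RepHom {
  hom_module : {additive rep_module A -> rep_module B};
  hom_group : {multiplicative rep_group A -> rep_group B};
  hom_scale : forall (c : K) (v : rep_module A),
    hom_module (rep_scale c v) = rep_scale c (hom_module v);
  hom_act : forall (v : rep_module A) (g : rep_group A),
    hom_module (rep_act v g) = rep_act (hom_module v) (hom_group g)
}.

Definition rep_ker A B (f : rep_hom A B) : set (rep_module A) :=
  [set v | hom_module f v = 0].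

(* The free right module [XKF(Y)] consists of the [X]-indexed families of
   elements of [KF(Y)], which acts on each component by right multiplication. *)
Definition free_rep (X Y : finType) : representation K :=
  @Representation K (free_group Y)
    {ffun X -> ((group_algebra K (free_group Y))^c)^o}.

Definition nabla (A : representation K) (X Y : finType)
    (T : set (rep_module (free_rep X Y))) : set (rep_hom (free_rep X Y) A) :=
  [set f | T `<=` rep_ker f].
Arguments nabla A {X Y} T.

Definition nabla_closure (A : representation K) (X Y : finType)
    (T : set (rep_module (free_rep X Y))) : set (rep_module (free_rep X Y)) :=
  \bigcap_(f in nabla A T) rep_ker f.
Arguments nabla_closure A {X Y} T.

Definition action_type_logically_noetherian (A : representation K) : Prop :=
  forall (X Y : finType) (T : set (rep_module (free_rep X Y)))
    (w : rep_module (free_rep X Y)), nabla_closure A T w ->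
  exists T0 : set (rep_module (free_rep X Y)),
    [/\ finite_set T0, T0 `<=` T & nabla_closure A T0 w].

End Representations.
Arguments nabla {K} A {X Y} T.
Arguments nabla_closure {K} A {X Y} T.

Section RightIdeals.
Context (A : nzRingType).

Definition right_ideal (I : set A) : Prop :=
  [/\ I 0, (forall x y, I x -> I y -> I (x - y)) &
      (forall x a, I x -> I (x * a))].

Definition fg_right_ideal (I : set A) : Prop :=
  right_ideal I /\
  exists2 S : set A, finite_set S & I = smallest right_ideal S.

End RightIdeals.

Section QuotientByRightIdeal.
Context (A : nzRingType) (I : set A) (rI : right_ideal I).

Definition ideal_pred of right_ideal I : {pred A} := fun x => x \in I.

Lemma ideal_pred_closed : zmod_closed (ideal_pred rI).
Proof.
have [I0 IB _] := rI; split=> [|x y]; rewrite !unfold_in.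
  exact: mem_set.
by move=> /set_mem Ix /set_mem Iy; apply/mem_set/IB.
Qed.

HB.instance Definition _ := GRing.isZmodClosed.Build A (ideal_pred rI)
  ideal_pred_closed.

Definition quotient_module := Quotient.quot (ideal_pred rI).

HB.instance Definition _ := GRing.Zmodule.on quotient_module.

Definition quotient_class (x : A) : quotient_module :=
  (\pi_(Quotient.quot (ideal_pred rI)) x)%qT.

Lemma quotient_classP x y : quotient_class x = quotient_class y <-> I (x - y).
Proof.
rewrite (rwP eqP) -Quotient.idealrBE; split; last exact: mem_set.
exact: set_mem.
Qed.

Lemma quotient_classD : {morph quotient_class : x y / x + y}.
Proof. exact: Quotient.pi_add. Qed.

Lemma quotient_class_surj q : quotient_class (repr q) = q.
Proof. exact: reprK. Qed.

Definition quotient_scale (a : A^c) (q : quotient_module) : quotient_module :=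
  quotient_class ((repr q : A) * (a : A)).

Lemma quotient_scaleE (a : A^c) (x : A) :
  quotient_scale a (quotient_class x) = quotient_class (x * (a : A)).
Proof.
apply/quotient_classP; rewrite -mulrBl; have [_ _] := rI; apply.
by apply/quotient_classP; rewrite quotient_class_surj.
Qed.

Lemma quotient_scaleA a b q :
  quotient_scale a (quotient_scale b q) = quotient_scale (a * b) q.
Proof.
by rewrite -[q]quotient_class_surj !quotient_scaleE -mulrA.
Qed.

Lemma quotient_scale1 : left_id 1 quotient_scale.
Proof.
by move=> q; rewrite -[q]quotient_class_surj quotient_scaleE mulr1.
Qed.

Lemma quotient_scaleDr : right_distributive quotient_scale +%R.
Proof.
move=> a p q; rewrite -[p]quotient_class_surj -[q]quotient_class_surj.
by rewrite -quotient_classD !quotient_scaleE mulrDl quotient_classD.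
Qed.

Lemma quotient_scaleDl q : {morph quotient_scale^~ q : a b / a + b}.
Proof.
move=> a b; rewrite -[q]quotient_class_surj !quotient_scaleE.
by rewrite -quotient_classD -mulrDr.
Qed.

HB.instance Definition _ := GRing.Zmodule_isLmodule.Build A^c quotient_module
  quotient_scaleA quotient_scale1 quotient_scaleDr quotient_scaleDl.

End QuotientByRightIdeal.

Section ProductModule.
Context (R : nzRingType) (I : Type) (V : I -> lmodType R).

Definition product_module := forall i, V i.
Implicit Types (u v w : product_module) (a b : R).

HB.instance Definition _ := Choice.on product_module.

Definition product_add u v : product_module := fun i => u i + v i.
Definition product_opp u : product_module := fun i => - u i.
Definition product_zero : product_module := fun i => 0.
Definition product_scale a u : product_module := fun i => a *: u i.

Lemma product_addA : associative product_add.
Proof. by move=> u v w; apply/functional_extensionality_dep => i; apply: addrA. Qed.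

Lemma product_addC : commutative product_add.
Proof. by move=> u v; apply/functional_extensionality_dep => i; apply: addrC. Qed.

Lemma product_add0 : left_id product_zero product_add.
Proof. by move=> u; apply/functional_extensionality_dep => i; apply: add0r. Qed.

Lemma product_addN : left_inverse product_zero product_opp product_add.
Proof. by move=> u; apply/functional_extensionality_dep => i; apply: addNr. Qed.

HB.instance Definition _ := GRing.isZmodule.Build product_module
  product_addA product_addC product_add0 product_addN.

Lemma product_scaleA a b u :
  product_scale a (product_scale b u) = product_scale (a * b) u.
Proof. by apply/functional_extensionality_dep => i; apply: scalerA. Qed.

Lemma product_scale1 : left_id 1 product_scale.
Proof. by move=> u; apply/functional_extensionality_dep => i; apply: scale1r. Qed.

Lemma product_scaleDr : right_distributive product_scale +%R.
Proof. by move=> a u v; apply/functional_extensionality_dep => i; apply: scalerDr. Qed.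

Lemma product_scaleDl u : {morph product_scale^~ u : a b / a + b}.
Proof. by move=> a b; apply/functional_extensionality_dep => i; apply: scalerDl. Qed.

HB.instance Definition _ := GRing.Zmodule_isLmodule.Build R product_module
  product_scaleA product_scale1 product_scaleDr product_scaleDl.

End ProductModule.

Definition F2 : groupType := free_group 'I_2.

Section ProductRepresentation.
Context (K : comNzRingType).
Local Notation KF2 := (group_algebra K F2).

Definition fg_right_ideals := {I : set KF2 | fg_right_ideal I}.

Definition fg_right_ideal_closed (j : fg_right_ideals) : right_ideal (sval j) :=
  proj1 (svalP j).

Definition fg_quotients_product : right_module KF2 :=
  @product_module KF2^c fg_right_ideals
    (fun j => quotient_module (fg_right_ideal_closed j)).

Definition fg_quotients_rep : representation K :=
  @Representation K F2 fg_quotients_product.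

End ProductRepresentation.

(* Main.v *)
(* Take X = {x}, Y = {a, b}, w = x, and T = {x o y_k -+ x | k in nat}, where
   y_k = a^k b a^-k and the signs s_k = +-1 remain to be chosen.

   Since K is countable, there are only countably many possibilities for the
   images of a and b in F2, a finitely generated right ideal V_j and a vector v
   of KF2/V_j; enumerate these data and use the k-th sign against the k-th datum.
   If v <> 0 then, as char K <> 2, v o beta(y_k) cannot be both v and -v, so some
   choice of s_k prevents v o beta(y_k) = s_k v.  Hence every homomorphism
   killing T kills x.

   On the other hand, whatever the signs, the right ideal of KF2 generated by
   all y_k - s_k is proper: let F2 act on the right on signed points of Z, a
   shifting the position and b multiplying the sign by s_n at position n; then
   y_k multiplies the sign by s_k at 0, so the linear form sending g to the sign
   of 0.g vanishes on the ideal but not at 1.  Therefore a finite subset T0 of T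
   generates a proper ideal V_j, and x |-> 1 + V_j kills T0 but not x. *)

From HB Require Import structures.
Require Import Defs.
From mathcomp Require Import all_boot all_algebra.
From mathcomp Require Import boolp classical_sets functions cardinality.
From mathcomp Require Import monalg.

Local Open Scope classical_set_scope.
Local Open Scope card_scope.
Local Open Scope ring_scope.

Import GRing.Theory.

Set Implicit Arguments.
Unset Strict Implicit.
Unset Printing Implicit Defensive.

(** * Countability of the data to be enumerated *)

Definition enumerable (T : Type) := exists e : nat -> T, forall x, exists n, e n = x.

Lemma enumerable_image (A B : Type) (f : A -> B) :
  (forall y, exists x, f x = y) -> enumerable A -> enumerable B.
Proof.
move=> fs [e es]; exists (f \o e) => y.
by have [x <-] := fs y; have [n <-] := es x; exists n.
Qed.

Lemma enumerable_count (T : countType) : inhabited T -> enumerable T.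
Proof.
move=> [t]; exists (fun n => odflt t (unpickle n)) => x.
by exists (pickle x); rewrite pickleK.
Qed.

Lemma enumerable_seq (A : Type) : enumerable A -> enumerable (seq A).
Proof.
move=> [e es]; apply: (@enumerable_image (seq nat) _ (map e)); last first.
  by apply: enumerable_count; exact: (inhabits [::]).
elim=> [|x s [r <-]]; first by exists [::].
by have [n <-] := es x; exists (n :: r).
Qed.

Lemma enumerable_prod (A B : Type) :
  enumerable A -> enumerable B -> enumerable (A * B).
Proof.
move=> [e es] [e' es'].
apply: (@enumerable_image (nat * nat) _ (fun p => (e p.1, e' p.2))).
  by case=> x y; have [m <-] := es x; have [n <-] := es' y; exists (m, n).
by apply: enumerable_count; exact: (inhabits (0%N, 0%N)).
Qed.

Lemma enumerable_free_group (Y : countType) : enumerable (free_group Y).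
Proof.
(* Words that are not reduced go to the identity by default. *)
apply: (@enumerable_image (seq (Y * bool)) _ (insubd (fg_one Y))).
  by move=> u; exists (val u); rewrite valKd.
by apply: enumerable_count; exact: (inhabits [::]).
Qed.

Lemma enumerable_group_algebra (K : comNzRingType) (G : groupType) :
  enumerable K -> enumerable G -> enumerable (group_algebra K G).
Proof.
move=> eK eG; apply: (@enumerable_image (seq (K * G)) _
  (fun s => \sum_(p <- s) (<< p.1 *g p.2 >> : {malg K[G]}))).
  move=> x; exists [seq (mcoeff g x, g) | g <- finmap.enum_fset (msupp x)].
  by rewrite big_map [RHS](monalgE (x : {malg K[G]})).
by apply: enumerable_seq; apply: enumerable_prod.
Qed.

Lemma enumerable_card (T : Type) : [set: T] #= [set: nat] -> enumerable T.
Proof.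
move/card_set_bijP => [f [_ finj fsurj]].
have /choice[e eP] : forall n, exists x, f x = n.
  by move=> n; have [x _ <-] := fsurj n I; exists x.
by exists e => x; exists (f x); apply: finj; rewrite ?inE ?eP.
Qed.

(** * Actions of a free group given letter by letter *)

Section Walk.
Context (Y : choiceType) (S : Type) (step : S -> Y * bool -> S).
Hypothesis stepK : forall st a, step (step st a) (letter_inv a) = st.

(** A cancellation in [push] drops a step followed by its inverse, so walks do not see reduction. *)
Lemma foldl_push st a w :
  foldl step st (push a w) = foldl step (step st a) w.
Proof. by case: w => //= b w; case: eqP => //= ->; rewrite stepK. Qed.

Lemma foldl_fg_mul st (g h : free_group Y) :
  foldl step st (fg_word (g * h)%g) =
  foldl step (foldl step st (fg_word g)) (fg_word h).
Proof.
rewrite -[fg_word (g * h)%g]/(word_mul (fg_word g) (fg_word h)).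
by elim: (fg_word g) st => //= a w IHw st; rewrite foldl_push IHw.
Qed.

End Walk.

(** * The signed walk on the integers *)

Definition shift_gen : F2 := free_gen (ord0 : 'I_2).
Definition lamp_gen : F2 := free_gen (ord_max : 'I_2).
(** Since [q ^ x] stands for x^-1 q x, this is p^k q p^-k. *)
Definition lamp_conj (G : groupType) (p q : G) (k : nat) : G := (q ^ (p ^- k))%g.

Lemma lamp_conj_morph (G H : groupType) (f : {multiplicative G -> H}) p q k :
  f (lamp_conj p q k) = lamp_conj (f p) (f q) k.
Proof.
(* [f] is only given as respecting products; cancellation yields the unit, and then conjugates and
   powers follow. *)
have f1 : f 1%g = 1%g by apply: (mulgI (f 1%g)); rewrite -gmulfM !mulg1.
pose uf := isUMagmaMorphism.Build G H f (f1, @gmulfM _ _ f).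
pose F : UMagmaMorphism.type G H := HB.pack (f : G -> H) uf.
exact: etrans (gmulfJ F _ _) (congr1 (conjg _) (gmulfXVn F _ _)).
Qed.

Section Lamps.
Context (s : nat -> bool).

(* A state is a position together with a sign, [true] encoding -1. *)
Definition lamp_step (st : int * bool) (a : 'I_2 * bool) : int * bool :=
  if a.1 == ord0 then (st.1 + (-1) ^+ a.2, st.2) else (st.1, st.2 (+) s `|st.1|%N).

Lemma lamp_stepK st a : lamp_step (lamp_step st a) (letter_inv a) = st.
Proof.
case: a st => y b [n c]; rewrite /lamp_step /letter_inv /=.
case: (y == ord0) => /=; last by rewrite addbK.
by case: b; rewrite ?subrK ?addrK.
Qed.

Definition lamp_walk st (g : F2) := foldl lamp_step st (fg_word g).

Lemma lamp_walkM st (g h : F2) :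
  lamp_walk st (g * h)%g = lamp_walk (lamp_walk st g) h.
Proof. exact: (foldl_fg_mul lamp_stepK). Qed.

Lemma lamp_walk_shift n b k : lamp_walk (n, b) (shift_gen ^+ k)%g = (n + k%:Z, b).
Proof.
elim: k n => [|k IHk] n; first by rewrite addr0.
by rewrite expgS lamp_walkM -[k.+1]add1n PoszD addrA -IHk.
Qed.

Lemma lamp_walk_conj b k :
  lamp_walk (0, b) (lamp_conj shift_gen lamp_gen k) = (0, b (+) s k).
Proof.
have back c : lamp_walk (k%:Z, c) (shift_gen ^- k)%g = (0, c).
  by rewrite -[k%:Z]add0r -(lamp_walk_shift 0) -lamp_walkM mulgV.
rewrite /lamp_conj /conjg invgK lamp_walkM lamp_walkM lamp_walk_shift add0r.
exact: back.
Qed.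

(** Positions evolve independently of the sign, so a flip at the start survives to the end. *)
Lemma lamp_walk_sign n b c g :
  (lamp_walk (n, b (+) c) g).2 = (lamp_walk (n, b) g).2 (+) c.
Proof.
rewrite /lamp_walk; elim: (fg_word g) n b => //= a w IHw n b.
by rewrite /lamp_step /=; case: ifP => _; rewrite -IHw // addbAC.
Qed.

(** * A linear form vanishing on the relations *)

Context (K : comNzRingType).
Local Notation KF2 := (group_algebra K F2).

Definition lamp_functional : {malg K[F2]} -> K :=
  mmap idfun (fun g => (-1) ^+ (lamp_walk (0, false) g).2).

Definition lamp_relation k : KF2 :=
  ga_elt K (lamp_conj shift_gen lamp_gen k) - (-1) ^+ s k.

(** By linearity let x be a group element g. The walk along y_k g reads y_k first and is back at 0
    with sign s_k before reading g, so y_k g and s_k g get the same value. *)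
Lemma lamp_functional_relation k (x : KF2) :
  lamp_functional (lamp_relation k * x) = 0.
Proof.
rewrite [x](monalgE (x : {malg K[F2]})) mulr_sumr.
rewrite /lamp_functional raddf_sum big1 // => g _.
rewrite mulrBl raddfB /= -[ga_elt _ _ * _]/(ga_mul _ _) ga_mulUU mul1r.
rewrite mulr_sign mmapU /= lamp_walkM lamp_walk_conj lamp_walk_sign signr_addb.
by case: (s k); rewrite /= ?mmapN mmapU /= ?expr1 ?expr0 ?mulrN1 ?mulr1 ?mulrN subrr.
Qed.

Lemma lamp_relations_proper (I : set KF2) :
  I `<=` range lamp_relation -> ~ smallest (@right_ideal KF2) I 1.
Proof.
(* The kernel of the form need not be a right ideal; [U] is the largest right ideal inside it. *)
pose U := [set a : KF2 | forall b : KF2, lamp_functional (a * b) = 0].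
move=> Irel sm1; have sub : smallest (@right_ideal KF2) I `<=` U.
  apply: smallest_sub; last by move=> _ /Irel[k _ <-] b; apply: lamp_functional_relation.
  split=> [b|x y Ux Uy b|x a Ux b].
  - by rewrite mul0r /lamp_functional raddf0.
  - by rewrite mulrBl /lamp_functional raddfB /= [mmap _ _ _]Ux [mmap _ _ _]Uy subrr.
  - by rewrite -mulrA; apply: Ux.
have /eqP := sub _ sm1 1.
by rewrite mulr1 /lamp_functional mmapU /= mul1r expr0 oner_eq0.
Qed.

End Lamps.

(** * Generated right ideals and their quotients *)

Lemma smallest_right_ideal (A : nzRingType) (S : set A) :
  right_ideal (smallest (@right_ideal A) S).
Proof.
split=> [|x y Sx Sy|x a Sx] I [rI SI]; have [I0 IB IM] := rI => //.
  by apply: (IB); [apply: Sx|apply: Sy].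
by apply: (IM); apply: Sx.
Qed.

Section QuotientClass.
Context (A : nzRingType) (I : set A) (rI : right_ideal I).

Lemma quotient_classB : {morph quotient_class rI : x y / x - y}.
Proof.
by move=> x y; apply/eqP; rewrite eq_sym subr_eq -quotient_classD subrK.
Qed.

Lemma quotient_class_eq0 x : quotient_class rI x = 0 <-> I x.
Proof.
have <- : quotient_class rI 0 = 0 by rewrite -(subrr 0) quotient_classB subrr.
by rewrite quotient_classP subr0.
Qed.

End QuotientClass.

(** * Homomorphisms from the free representation on one vector *)

Section Relations.
Context (K : comNzRingType).
Local Notation KF2 := (group_algebra K F2).
Local Notation W := (free_rep K unit 'I_2).

Definition free_vec (x : KF2) : rep_module W := [ffun=> x].

Definition lamp_vec (s : nat -> bool) (k : nat) : rep_module W :=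
  rep_act (free_vec 1) (lamp_conj shift_gen lamp_gen k) - (-1) ^+ s k *: free_vec 1.

Lemma lamp_vecE s k : lamp_vec s k = free_vec (lamp_relation s K k).
Proof.
have regE (a : KF2) : (a : KF2^c) *: (1 : (KF2^c)^o) = a by exact: (mul1r (a : KF2)).
apply/ffunP => i; rewrite !ffunE /lamp_relation.
congr (_ - _); first exact: regE.
(* The left power is taken in the converse ring, the right one in [KF2]; they agree for exponents 0
   and 1. *)
by rewrite [LHS]regE; case: (s k).
Qed.

Section ClassHom.
Context (j : fg_right_ideals K).

(* Multiplying by a Kronecker delta before taking the class avoids a transport
   along [i = j]. *)
Definition class_at (x : KF2) : fg_quotients_product K := fun i =>
  quotient_class (fg_right_ideal_closed i) (if `[< i = j >] then x else 0).

Definition class_module (v : rep_module W) : rep_module (fg_quotients_rep K) :=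
  class_at (v tt).

Lemma class_module_additive : zmod_morphism class_module.
Proof.
move=> u v; apply/functional_extensionality_dep => i.
transitivity (class_at (u tt) i - class_at (v tt) i); last by [].
by rewrite /class_module /class_at -quotient_classB !ffunE; case: asbool; rewrite ?subr0.
Qed.

HB.instance Definition _ :=
  GRing.isZmodMorphism.Build _ _ class_module class_module_additive.

Lemma class_module_scale (v : rep_module W) (a : KF2) :
  class_module (right_scale v a) = right_scale (class_module v) a.
Proof.
apply/functional_extensionality_dep => i.
transitivity (quotient_scale (a : KF2^c) (class_at (v tt) i)); last by [].
rewrite /class_module /class_at quotient_scaleE !ffunE.
by case: asbool; rewrite ?mul0r.
Qed.

Definition class_hom : rep_hom W (fg_quotients_rep K) :=
  @RepHom K W (fg_quotients_rep K) class_module idfun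
    (fun c v => class_module_scale v _) (fun v g => class_module_scale v _).

(** Coordinates other than [j] are classes of 0, so the kernel is the ideal itself. *)
Lemma class_hom_eq0 (v : rep_module W) :
  hom_module class_hom v = 0 <-> sval j (v tt).
Proof.
rewrite -(quotient_class_eq0 (fg_right_ideal_closed j)); split=> [|vj].
  move=> /(congr1 (fun u : fg_quotients_product K => u j)).
  by rewrite /= /class_module /class_at asboolT.
apply/functional_extensionality_dep => i; rewrite /= /class_module /class_at.
case: asboolP => [->|_]; first exact: vj.
by apply/quotient_class_eq0; case: (fg_right_ideal_closed i).
Qed.

End ClassHom.

Lemma hom_lamp_vec (A : representation K) (f : rep_hom W A) s k :
  let v := hom_module f (free_vec 1) in
  hom_module f (lamp_vec s k) =
  rep_act v (lamp_conj (hom_group f shift_gen) (hom_group f lamp_gen) k)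
    - (-1) ^+ s k *: v.
Proof.
move=> v; rewrite /lamp_vec raddfB hom_act !scaler_sign (fun_if (hom_module f)) raddfN.
by rewrite lamp_conj_morph.
Qed.

End Relations.

(** * The diagonal choice of signs *)

Lemma oppr_fixed_eq0 (R : pzRingType) (V : lmodType R) (h : R) (v : V) :
  h *+ 2 = 1 -> v = - v -> v = 0.
Proof.
(* v = h v + h v = h (v + v) = h (v - v). *)
move=> h2 vN; rewrite -[v]scale1r -h2 mulr2n scalerDl -scalerDr {2}vN subrr.
exact: scaler0.
Qed.

Lemma exists_separating_signs (K : fieldType) :
  enumerable K -> 2%N \notin [pchar K] ->
  exists s, forall f : rep_hom (free_rep K unit 'I_2) (fg_quotients_rep K),
    hom_module f (free_vec 1) <> 0 ->
    exists k, hom_module f (lamp_vec K s k) <> 0.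
Proof.
move=> eK char2; set KF2 := group_algebra K F2.
have eF2 : enumerable F2 by apply: enumerable_free_group.
have eKF2 : enumerable KF2 by apply: enumerable_group_algebra.
have [code codeP] : enumerable (F2 * F2 * seq KF2 * KF2).
  apply: (enumerable_prod _ eKF2); apply: (enumerable_prod _ (enumerable_seq eKF2)).
  exact: enumerable_prod.
(* The sign is -1 exactly when, in the k-th datum, y_k fixes the class of [z] modulo the ideal
   generated by [gs]. *)
pose s k := let: (p, q, gs, z) := code k in
  `[< smallest (@right_ideal KF2) [set` gs] (z * ga_elt K (lamp_conj p q k) - z) >].
exists s => f fx_neq0.
(* One nonzero coordinate suffices, and it is coded by finite data: generators of the ideal and a
   representative. *)
have [j fxj_neq0] : exists j, (hom_module f (free_vec 1) : fg_quotients_product K) j <> 0.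
  apply: contrapT => /forallNP fx0; apply: fx_neq0.
  by apply/functional_extensionality_dep => j; exact: (contrapT (fx0 j)).
have [_ [_ /finite_seqP[gs ->] jE]] := svalP j.
set v := (hom_module f (free_vec 1) : fg_quotients_product K) j in fxj_neq0.
have [k kE] := codeP (hom_group f shift_gen, hom_group f lamp_gen, gs, repr v).
exists k; rewrite hom_lamp_vec => /(congr1 (fun u : fg_quotients_product K => u j)).
set g := lamp_conj _ _ k => fkj.
have {}fkj : right_scale v (ga_elt K g) = (-1) ^+ s k *: v.
  by apply/eqP; rewrite -subr_eq0; apply/eqP.
have sP : s k <-> right_scale v (ga_elt K g) = v.
  rewrite -[X in _ = X](quotient_class_surj (rI := fg_right_ideal_closed j)).
  rewrite /s kE -/g -jE; symmetry.
  exact: (iff_trans (quotient_classP _ (repr v * ga_elt K g) _) (rwP (asboolP _))).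
(* With sign -1, [v] is both fixed and negated, hence 0; with sign +1, [v] would be fixed, which
   forces the sign -1. *)
apply: fxj_neq0; case: (s k) sP fkj => sP fkj.
  have vg := sP.1 isT.
  have half : (2%:R^-1 : K)%:A *+ 2 = 1 :> KF2.
    by rewrite scalerMnl -mulr_natr mulVf ?scale1r.
  apply: (@oppr_fixed_eq0 KF2^c _ (2%:R^-1 : K)%:A v half).
  by rewrite -{1}vg fkj expr1 scaleN1r.
by have := sP.2 (etrans fkj (scale1r v)).
Qed.

(** * No finite subset of the relations suffices *)

Theorem theorem9p1 (K : fieldType)
    (K_countable : [set: K] #= [set: nat]) (K_char : 2%N \notin [pchar K]) :
  ~ action_type_logically_noetherian (fg_quotients_rep K).
Proof.
have [s sP] := exists_separating_signs (enumerable_card K_countable) K_char.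
move=> /(_ unit 'I_2 (range (lamp_vec K s)) (free_vec 1)) [].
  move=> f /= fT; apply: contrapT => /sP[k]; apply; exact: fT.
move=> T0 [T0fin T0T wT0].
pose I := [set t tt | t in T0] : set (group_algebra K F2).
have Ifg : fg_right_ideal (smallest (@right_ideal _) I).
  by split; [apply: smallest_right_ideal|exists I; rewrite // /I; apply: finite_image].
apply: (@lamp_relations_proper s K I).
  by move=> _ [t /T0T[k _ <-] <-]; exists k => //; rewrite lamp_vecE ffunE.
(* The homomorphism attached to the ideal generated by [I] kills [T0], hence x, which puts 1 into
   that ideal. *)
have := wT0 (class_hom (exist _ _ Ifg)); rewrite /rep_ker /= => -/(_ _)/class_hom_eq0.
rewrite ffunE; apply => t T0t.
by apply/class_hom_eq0; apply: sub_gen_smallest; exists t.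
Qed.
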